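(* For every integer $k\geqslant2$, the ghost measure of the $k$-Zaremba sequence $z_k$ exists and is singular continuous, i.e. it has no atoms and is singular with respect to Lebesgue measure (its distribution function is continuous with derivative $0$ Lebesgue-almost everywhere).
   Context: For $k\geqslant2$ let ${\bf B}_i=\begin{pmatrix}i+1&1\\1&0\end{pmatrix}$ for $i=0,\dots,k-1$. The $k$-Zaremba sequence is $z_k(m)=(1\ 0)\,{\bf B}_{i_s}\cdots{\bf B}_{i_1}{\bf B}_{i_0}\,e_1$ for $m\geqslant1$ with base-$k$ expansion $i_s\cdots i_1i_0$, where $e_1=(1,0)^T$; it is a $k$-regular sequence with digit matrices ${\bf B}_0,\dots,{\bf B}_{k-1}$. For a sequence $f$, let $\Sigma(n)=\sum_{m=k^n}^{k^{n+1}-1}f(m)$ and $\mu_n=\frac1{\Sigma(n)}\sum_{m=0}^{k^{n+1}-k^n-1}f(k^n+m)\,\delta_{m/(k^n(k-1))}$ (probability measures on $\mathbb T=[0,1)$); the ghost measure of $f$ is the weak limit of $(\mu_n)$. *)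

(* Defs.v *)
From HB Require Import structures.
From mathcomp Require Import all_boot all_order all_algebra.
From mathcomp Require Import all_classical all_reals all_analysis.
Set Implicit Arguments. Unset Strict Implicit. Unset Printing Implicit Defensive.
Import Order.TTheory GRing.Theory Num.Theory.
Import numFieldNormedType.Exports.
Local Open Scope classical_set_scope.
Local Open Scope ring_scope.

Definition Bmat (i : nat) : 'M[int]_2 :=
  \matrix_(a < 2, b < 2)
    (if (a == 0 :> nat) && (b == 0 :> nat) then (i.+1)%:Z
     else if (a == 0 :> nat) || (b == 0 :> nat) then 1 else 0).

(* zprod k fuel m = B_{i_s} ... B_{i_1} B_{i_0} where i_s...i_0 is the
   base-k expansion of m (identity for m = 0); fuel bounds the recursion
   depth, and fuel = m is always enough when k >= 2. *)
Fixpoint zprod (k fuel m : nat) : 'M[int]_2 :=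
  match fuel with
  | 0 => 1%:M
  | fuel'.+1 =>
      if m == 0%N then 1%:M
      else zprod k fuel' (m %/ k) *m Bmat (m %% k)
  end.

Definition zaremba (k m : nat) : int :=
  ((\row_(j < 2) (if (j == 0 :> nat) then 1 else 0 : int))
     *m zprod k m m
     *m (\col_(j < 2) (if (j == 0 :> nat) then 1 else 0 : int))) 0 0.

Definition Sigma {R : realType} (f : nat -> int) (k n : nat) : R :=
  \sum_(k ^ n <= m < k ^ n.+1) (f m)%:~R.

Definition mu_n_integral {R : realType} (f : nat -> int) (k n : nat)
    (g : R -> R) : R :=
  (\sum_(0 <= m < k ^ n.+1 - k ^ n)
      (f (k ^ n + m)%N)%:~R * g (m%:R / (k ^ n * (k - 1))%:R))
  / Sigma f k n.

Definition torus_test_fun {R : realType} (g : R -> R) : Prop :=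
  continuous g /\ forall x, g (x + 1) = g x.

(* mu is a probability measure on T = [0,1) (a Borel measure on R
   carried by [0,1)) and is the weak limit of the mu_n. *)
Definition is_ghost_measure {R : realType} (f : nat -> int) (k : nat)
    (mu : {measure set (measurableTypeR R) -> \bar R}) : Prop :=
  mu setT = 1%E /\ mu (~` `[0%R, 1%R[) = 0%E /\
  forall g : R -> R, torus_test_fun g ->
    (fun n => (mu_n_integral f k n g)%:E) @ \oo -->
      (\int[mu]_(x in `[0%R, 1%R[) (g x)%:E)%E.

Definition singular_continuous {R : realType}
    (mu : {measure set (measurableTypeR R) -> \bar R}) : Prop :=
  (forall x : R, mu [set x] = 0%E) /\
  exists A : set (measurableTypeR R),
    measurable A /\ (@lebesgue_measure R) A = 0%E /\ mu (~` A) = 0%E.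

(* Main.v *)
Require Import Defs.
From HB Require Import structures.
From mathcomp Require Import all_boot all_order all_algebra.
From mathcomp Require Import all_classical all_reals all_analysis.
From mathcomp Require Import measurable_realfun.
From mathcomp Require Import ring lra zify.

(* Write l = k - 1 and let rho be the Perron eigenvalue of B = B_0 + ... + B_(k-1),
   with eigenvector v = (rho, k)^T and second eigenvalue sigma.  Since e_1 is a
   multiple of v - (sigma, k)^T, the sum of z_k over the k^d descendants of M is
   (rho^d W(M) - sigma^d W'(M)) / (rho - sigma), where W(M) = e_1^T B_(M) v, so
   the mu_n-mass of the cell [m / (k^j l), (m + 1) / (k^j l)) tends to
   w j m = W(k^j + m) / (rho^j N).  A measure with these cell masses is the image
   of Lebesgue measure on [0, 1) under the quantile function of w, and convergence
   of cell masses gives weak convergence.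

   A child never receives more than the fraction (rho - 1) / rho of the mass of
   its parent, so there are no atoms.  As the first entry of e_1^T B_(M) is at
   least its second entry, the last child outweighs the first one by a fixed
   fraction of the parent; hence the conditional digit distribution stays away
   from the uniform one, the Hellinger affinity between w j and Lebesgue measure on
   the cells of level j decays geometrically, and Borel-Cantelli gives
   singularity. *)

Set Implicit Arguments.
Unset Strict Implicit.
Unset Printing Implicit Defensive.
Import Order.TTheory GRing.Theory Num.Theory.
Import numFieldNormedType.Exports.
Local Open Scope classical_set_scope.
Local Open Scope ring_scope.

(** * Measures with prescribed cell masses *)

Lemma sum_nat_block (V : nmodType) (b n : nat) (F : nat -> V) :
  \sum_(0 <= i < b * n) F i =
  \sum_(0 <= m < n) \sum_(0 <= r < b) F (b * m + r)%N.
Proof.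
rewrite mulnC big_nat_mul; apply: eq_bigr => i _.
rewrite -{1}(add0n (i * b)%N) mulSn big_addn addnK.
by apply: eq_bigr => r _; rewrite addnC mulnC.
Qed.

Section CellMeasure.
Context {R : realType} (k l : nat).
Implicit Type w : nat -> nat -> R.

(** For [l = k - 1] the left endpoints at level [j] are the support points of mu_j; the children of
    cell [m] are the cells [k * m + i], [i < k], of the next level. *)
Definition cell (j m : nat) : set R :=
  `[m%:R / (k ^ j * l)%:R, m.+1%:R / (k ^ j * l)%:R[.

Definition mass_distribution w : Prop :=
  [/\ forall j m, 0 <= w j m,
      forall j m, \sum_(0 <= i < k) w j.+1 (k * m + i)%N = w j m &
      \sum_(0 <= m < l) w 0 m = 1].

Definition vanishing_mass w : Prop :=
  forall e : R, 0 < e ->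
    \forall j \near \oo, forall m, (m < k ^ j * l)%N -> w j m < e.

Definition cumulative_mass w (j m : nat) : R := \sum_(0 <= i < m) w j i.

(** Generalized inverse of the distribution function with value [cumulative_mass w j m] at the grid
    point [m / (k^j * l)]. *)
Definition mass_quantile w (t : R) : R :=
  sup [set q | exists j m, [/\ (m <= k ^ j * l)%N,
    q = m%:R / (k ^ j * l)%:R & cumulative_mass w j m <= t]].

Hypothesis (k1 : (1 < k)%N) (l0 : (0 < l)%N).

Lemma cells_gt0 j : (0 < k ^ j * l)%N.
Proof. by rewrite muln_gt0 expn_gt0 (ltnW k1) l0. Qed.

Section Distribution.
Variable w : nat -> nat -> R.
Hypothesis wP : mass_distribution w.

Let w_ge0 j m : 0 <= w j m. Proof. by case: wP. Qed.

Lemma cumulative_massS j m :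
  cumulative_mass w j.+1 (k * m) = cumulative_mass w j m.
Proof.
have [_ wS _] := wP.
by rewrite /cumulative_mass sum_nat_block; apply: eq_bigr.
Qed.

Lemma cumulative_massD j d m :
  cumulative_mass w (j + d) (k ^ d * m) = cumulative_mass w j m.
Proof.
elim: d => [|d IH]; first by rewrite addn0 mul1n.
by rewrite addnS expnS -mulnA cumulative_massS.
Qed.

Lemma le_cumulative_mass j m n : (m <= n)%N ->
  cumulative_mass w j m <= cumulative_mass w j n.
Proof.
move=> mn; rewrite /cumulative_mass (big_cat_nat (leq0n m) mn)//= lerDl.
exact: sumr_ge0.
Qed.

(** Both grid points are refined to the common level [j + j'], where the hypothesis compares their
    indices. *)
Lemma cumulative_mass_mono j m j' m' : (m * k ^ j' <= m' * k ^ j)%N ->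
  cumulative_mass w j m <= cumulative_mass w j' m'.
Proof.
move=> mm; rewrite -(cumulative_massD j j') -(cumulative_massD j' j) (addnC j').
by apply: le_cumulative_mass; rewrite mulnC (mulnC _ m').
Qed.

Lemma cumulative_mass_total j : cumulative_mass w j (k ^ j * l) = 1.
Proof. by rewrite -(add0n j) cumulative_massD; case: wP. Qed.

Lemma grid_le j m j' m' :
  (m%:R / (k ^ j * l)%:R <= m'%:R / (k ^ j' * l)%:R :> R) =
  (m * k ^ j' <= m' * k ^ j)%N.
Proof.
rewrite ler_pdivrMr ?ltr0n ?cells_gt0// mulrAC ler_pdivlMr ?ltr0n ?cells_gt0//.
by rewrite -!natrM ler_nat !mulnA leq_pmul2r.
Qed.

Let E t := [set q : R | exists j m, [/\ (m <= k ^ j * l)%N,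
    q = m%:R / (k ^ j * l)%:R & cumulative_mass w j m <= t]].

Let E0 t : 0 <= t -> E t 0.
Proof. by move=> t0; exists 0%N, 0%N; rewrite mul0r /cumulative_mass big_nil. Qed.

Let E_ub t q : E t q -> q <= 1.
Proof.
move=> [j [m [mk -> _]]].
by rewrite ler_pdivrMr ?ltr0n ?cells_gt0// mul1r ler_nat.
Qed.

Let E_has_sup t : 0 <= t -> has_sup (E t).
Proof. by move=> t0; split; [exists 0; exact: E0 | exists 1 => q /E_ub]. Qed.

Lemma mass_quantile_ge0 t : 0 <= mass_quantile w t.
Proof.
have [t0|t0] := leP 0 t.
  by apply: sup_upper_bound; [exact: E_has_sup | exact: E0].
(* For negative [t] the set is empty, and its supremum is [0] by convention. *)
rewrite /mass_quantile [X in sup X](_ : _ = set0) ?sup0//.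
apply/seteqP; split => // q [j [m [_ _]]] /le_lt_trans => /(_ _ t0).
by rewrite ltNge sumr_ge0.
Qed.

Lemma mass_quantile_nondecreasing : nondecreasing_fun (mass_quantile w).
Proof.
move=> s t st; have [s0|s0] := leP 0 s.
  apply: sup_le => //.
  - move=> q [j [m [mk qE S]]]; apply/downP; exists q => //; exists j, m.
    by split => //; exact: le_trans st.
  - by exists 0; exact: E0.
  - by apply: E_has_sup; exact: le_trans st.
rewrite {1}/mass_quantile [X in sup X](_ : _ = set0) ?sup0 ?mass_quantile_ge0//.
apply/seteqP; split => // q [j [m [_ _]]] /le_lt_trans => /(_ _ s0).
by rewrite ltNge sumr_ge0.
Qed.

Lemma mass_quantile_ge j m t : (m <= k ^ j * l)%N -> 0 <= t ->
  cumulative_mass w j m <= t -> m%:R / (k ^ j * l)%:R <= mass_quantile w t.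
Proof.
move=> mk t0 St; apply: sup_upper_bound; first exact: E_has_sup.
by exists j, m.
Qed.

Hypothesis w_vanish : vanishing_mass w.

(* Because the last subcell of a cell carries arbitrarily small mass, the
   supremum stays strictly below the right endpoint of the cell. *)
Lemma mass_quantile_lt j m t : (m <= k ^ j * l)%N -> 0 <= t ->
  t < cumulative_mass w j m -> mass_quantile w t < m%:R / (k ^ j * l)%:R.
Proof.
move=> mk t0 tS.
have m0 : (0 < m)%N.
  by rewrite lt0n; apply: contraTneq tS => ->; rewrite /cumulative_mass big_nil -leNgt.
have [N _ HN] : \forall j0 \near \oo, forall i, (i < k ^ j0 * l)%N ->
    w j0 i < cumulative_mass w j m - t by apply: w_vanish; rewrite subr_gt0.
have kd0 : (0 < k ^ N)%N by rewrite expn_gt0 (ltnW k1).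
have kdm : (k ^ N * m = (k ^ N * m).-1.+1)%N by rewrite prednK ?muln_gt0 ?kd0.
set m' := (k ^ N * m).-1 in kdm.
have wlt : w (j + N) m' < cumulative_mass w j m - t.
  apply: HN; first by rewrite /= leq_addl.
  by rewrite -kdm addnC expnD -mulnA leq_mul2l mk orbT.
(* Without the last subcell [m'] the cumulative mass still exceeds [t], so every grid point in the
   set is at most the left endpoint of [m']. *)
have tS' : t < cumulative_mass w (j + N) m'.
  move: wlt; rewrite -(cumulative_massD j N) kdm /cumulative_mass big_nat_recr//=.
  lra.
apply: (@le_lt_trans _ _ (m'%:R / (k ^ (j + N) * l)%:R)).
  apply: ge_sup; first by exists 0; exact: E0.
  move=> q [j1 [m1 [m1k -> S1]]]; rewrite grid_le leqNgt.
  apply/negP => /ltnW /cumulative_mass_mono /le_trans => /(_ _ S1).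
  by rewrite leNgt tS'.
rewrite ltNge grid_le -ltnNge expnD mulnA mulnAC ltn_pmul2r ?expn_gt0 ?(ltnW k1)//.
by rewrite mulnC kdm.
Qed.

(** Among nonnegative [t], the preimage of a cell is thus an interval of length [w j m]. *)
Lemma mass_quantile_cell j m t : (m < k ^ j * l)%N -> 0 <= t ->
  cell j m (mass_quantile w t) <->
  cumulative_mass w j m <= t < cumulative_mass w j m.+1.
Proof.
move=> mk t0; rewrite /cell/= in_itv/=; split=> /andP[h1 h2]; apply/andP; split.
- by rewrite leNgt; apply/negP => /(mass_quantile_lt (ltnW mk) t0); rewrite ltNge h1.
- by rewrite ltNge; apply/negP => /(mass_quantile_ge mk t0); rewrite leNgt h2.
- exact: mass_quantile_ge (ltnW mk) t0 h1.
- exact: mass_quantile_lt mk t0 h2.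
Qed.

Lemma mass_quantile_lt1 t : 0 <= t < 1 -> mass_quantile w t < 1.
Proof.
move=> /andP[t0 t1].
have -> : 1 = (k ^ 0 * l)%:R / (k ^ 0 * l)%:R :> R.
  by rewrite divff// pnatr_eq0 -lt0n cells_gt0.
by apply: mass_quantile_lt => //; rewrite cumulative_mass_total.
Qed.

Lemma cell_measure_exists :
  exists mu : {measure set (measurableTypeR R) -> \bar R},
    [/\ mu setT = 1%E, mu (~` `[0, 1[) = 0%E &
        forall j m, (m < k ^ j * l)%N -> mu (cell j m) = (w j m)%:E].
Proof.
pose T := measurableTypeR R.
have mD : measurable (`[0%R, 1%R[ : set T) by exact: measurable_itv.
have mQ : measurable_fun [set: T] (mass_quantile w : T -> T).
  exact: nondecreasing_measurable mass_quantile_nondecreasing.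
pose leb := mrestr (@lebesgue_measure R) mD.
unshelve eexists (pushforward leb (mass_quantile w : T -> T) :
  {measure set T -> \bar R}); first exact: mQ.
split.
- rewrite /= /pushforward preimage_setT /leb /mrestr setTI lebesgue_measure_itv/=.
  by rewrite lte_fin ltr01 oppr0 addr0.
- rewrite /= /pushforward /leb /mrestr.
  rewrite [X in lebesgue_measure X](_ : _ = set0) ?measure0//.
  apply/seteqP; split => // t [/= h]; rewrite in_itv/= => t01; apply: h.
  by rewrite in_itv/= mass_quantile_ge0 mass_quantile_lt1.
- move=> j m mk; rewrite /= /pushforward /leb /mrestr.
  rewrite [X in lebesgue_measure X](_ : _ =
    `[cumulative_mass w j m, cumulative_mass w j m.+1[%classic).
    rewrite lebesgue_measure_itv/= lte_fin.
    have -> : cumulative_mass w j m.+1 = cumulative_mass w j m + w j m.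
      by rewrite /cumulative_mass big_nat_recr.
    rewrite ltrDl; case: ltP => w0.
      by rewrite -EFinB; congr (_%:E); lra.
    by congr (_%:E); apply/eqP; rewrite eq_le w0 w_ge0.
  apply/seteqP; split => t /=; rewrite !in_itv/=.
    by move=> [h /andP[t0 t1]]; apply/(mass_quantile_cell mk t0).
  move=> h; have t0 : 0 <= t.
    by case/andP: h => h _; apply: le_trans h; exact: sumr_ge0.
  split; first exact/(mass_quantile_cell mk t0).
  rewrite t0/=; case/andP: h => _ /lt_le_trans; apply.
  by rewrite -(cumulative_mass_total j); exact: le_cumulative_mass.
Qed.

End Distribution.
End CellMeasure.

(** * Borel-Cantelli and uniform continuity *)

Lemma measure_bigsetU_le d (T : measurableType d) (R : realType)
    (mu : {measure set T -> \bar R}) (I : Type) (s : seq I) (P : pred I)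
    (F : I -> set T) : (forall i, measurable (F i)) ->
  (mu (\big[setU/set0]_(i <- s | P i) F i) <= \sum_(i <- s | P i) mu (F i))%E.
Proof.
move=> mF; elim: s => [|i s IH]; first by rewrite !big_nil measure0.
rewrite !big_cons; case: ifP => // _; apply: le_trans (leeD2l _ IH).
by apply: measureU2 => //; exact: bigsetU_measurable.
Qed.

(** The measures have sum at most [C / (1 - eta)], so Borel-Cantelli applies. *)
Lemma lim_sup_set_geometric0 d (T : measurableType d) (R : realType)
    (mu : {measure set T -> \bar R}) (F : nat -> set T) (C eta : R) :
  (forall n, measurable (F n)) -> 0 <= C -> 0 <= eta < 1 ->
  (forall n, (mu (F n) <= (C * eta ^+ n)%:E)%E) -> mu (lim_sup_set F) = 0%E.
Proof.
move=> mF C0 /andP[e0 e1] muF; apply: lim_sup_set_cvg0 => //.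
apply: (@le_lt_trans _ _ (C / (1 - eta))%:E); last exact: ltry.
apply: lime_le; first exact: is_cvg_nneseries.
apply: nearW => n.
apply: (@le_trans _ _ (\sum_(0 <= i < n) (C * eta ^+ i)%:E)%E).
  by apply: lee_sum => i _; exact: muF.
rewrite sumEFin lee_fin.
have -> : \sum_(0 <= i < n) C * eta ^+ i = series (geometric C eta) n by [].
rewrite geometric_seriesE ?lt_eqF//=.
have d0 : 0 < 1 - eta by rewrite subr_gt0.
rewrite ler_pM2r ?invr_gt0// ler_piMr// lerBlDr lerDl.
exact: exprn_ge0.
Qed.

Lemma segment_uniform_continuity (R : realType) (g : R -> R) (e : R) :
  continuous g -> 0 < e ->
  exists2 d : R, 0 < d & forall x y, 0 <= x <= 1 -> `|x - y| < d ->
    `|g x - g y| < e.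
Proof.
move=> cg e0.
have e20 : 0 < e / 2 by rewrite divr_gt0.
have := @segment_compact R 0 1; rewrite compact_near_coveringP.
(* Near-covering compactness, used with [d] tending to [0] from the right, yields one [d] valid for
   all [x] of the segment. *)
move=> /(_ R (0^'+) (fun d x => forall y, `|x - y| < d -> `|g x - g y| < e) _).
case=> [x _|d /= d0 H].
  have /cvgrPdist_lt /(_ _ e20) := cg x.
  move=> /nbhs_ballP[r /= r0 rP].
  have r20 : 0 < r / 2 by rewrite divr_gt0.
  exists (ball x (r / 2), [set d | d < r / 2]) => /=.
    by split; [exact: nbhsx_ballx | exact: nbhs_right_lt].
  move=> [x' d] /= [xx' dr] y x'y.
  have h1 : `|g x - g x'| < e / 2 by apply: rP; apply: lt_trans xx' _; lra.
  have h2 : `|g x - g y| < e / 2.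
    apply: rP; rewrite /ball/=; move: xx'; rewrite /ball/= => xx'.
    by have := ler_distD x' x y; lra.
  by have := ler_distD (g x) (g x') (g y); rewrite (distrC (g x') (g x)); lra.
(* Here [d] is the radius of a right neighborhood of [0], and [d / 2] is a point of it. *)
exists (d / 2); first by rewrite divr_gt0.
move=> x y x01; apply: H; rewrite ?divr_gt0//=.
  by rewrite sub0r normrN ger0_norm ?divr_ge0 ?ltW// ltr_pdivrMr// ltr_pMr// ltr1n.
Qed.

(** * Absence of atoms and singularity from cell masses *)

Section CellMeasureProperties.
Context {R : realType} (k l : nat).
Hypothesis (k1 : (1 < k)%N) (l0 : (0 < l)%N).
Variables (w : nat -> nat -> R) (mu : {measure set (measurableTypeR R) -> \bar R}).
Hypothesis wP : mass_distribution k l w.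
Hypothesis mu_cell : forall j m, (m < k ^ j * l)%N ->
  mu (cell k l j m) = (w j m)%:E.
Hypothesis mu_out : mu (~` `[0, 1[) = 0%E.

Let w_ge0 j m : 0 <= w j m. Proof. by case: wP. Qed.
Let L0 j : 0 < (k ^ j * l)%:R :> R.
Proof. by rewrite ltr0n cells_gt0. Qed.

Lemma measurable_cell j m : @measurable _ (measurableTypeR R) (cell k l j m).
Proof. exact: measurable_itv. Qed.

Lemma cellE j m (x : R) :
  cell k l j m x <-> m%:R <= x * (k ^ j * l)%:R < m.+1%:R.
Proof. by rewrite /cell/= in_itv/= ler_pdivrMr ?L0// ltr_pdivlMr ?L0. Qed.

Lemma lebesgue_cell j m :
  lebesgue_measure (cell k l j m : set R) = ((k ^ j * l)%:R^-1)%:E.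
Proof.
rewrite lebesgue_measure_itv/= lte_fin ltr_pM2r ?invr_gt0// ltr_nat leqnn.
by rewrite -EFinB -mulrBl -natrB// subSnn mul1r.
Qed.

Lemma cell_cover j (x : R) : 0 <= x < 1 ->
  exists2 m, (m < k ^ j * l)%N & cell k l j m x.
Proof.
move=> /andP[x0 x1]; exists (Num.truncn (x * (k ^ j * l)%:R)).
  by rewrite truncn_lt_nat ?mulr_ge0// gtr_pMl.
by apply/cellE; apply: truncn_itv; rewrite mulr_ge0.
Qed.

Lemma cell_sub01 j m : (m < k ^ j * l)%N ->
  cell k l j m `<=` (`[0, 1[%classic : set R).
Proof.
move=> mk x; rewrite /cell/= !in_itv/= => /andP[h1 h2]; apply/andP; split.
  by apply: le_trans h1; rewrite divr_ge0.
by apply: (lt_le_trans h2); rewrite ler_pdivrMr// mul1r ler_nat.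
Qed.

Lemma trivIset_cell j : trivIset setT (@cell R k l j).
Proof.
move=> m n _ _ [x [/cellE/truncn_def <- /cellE/truncn_def <-]]//.
Qed.

Lemma itv01_cells j :
  `[0, 1[%classic = \big[setU/set0]_(0 <= m < k ^ j * l) cell k l j m :> set R.
Proof.
rewrite big_mkord -bigcup_mkord; apply/seteqP; split => [x|x [m /= mk]].
  by rewrite /= in_itv/= => /(cell_cover j)[m mk xm]; exists m.
exact: cell_sub01.
Qed.

Lemma cell_measure_atomless : vanishing_mass k l w ->
  forall x : R, mu [set x] = 0%E.
Proof.
move=> wv x; apply/eqP; rewrite eq_le measure_ge0 andbT.
have [x01|x01] := boolP (x \in `[0%R, 1%R[); last first.
  rewrite -mu_out; apply: le_measure; rewrite ?inE//.
  - exact: measurableC (measurable_itv _).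
  - by move=> _ -> /= h; rewrite h in x01.
apply/lee_addgt0Pr => e e0; rewrite add0e.
have [j _ /(_ j (leqnn _)) H] := wv e e0.
have [m mk xm] := @cell_cover j x ltac:(by rewrite in_itv in x01).
apply: (@le_trans _ _ (mu (cell k l j m))).
  by apply: le_measure; rewrite ?inE//; [exact: measurable_cell | move=> _ ->].
by rewrite mu_cell// lee_fin ltW// H.
Qed.

(* A cell is called heavy when its mass exceeds its length; both the length of
   the heavy cells and the mass of the light ones are at most the affinity. *)
Lemma cell_measure_singular (C eta : R) : 0 <= C -> 0 <= eta < 1 ->
  (forall j, \sum_(0 <= m < k ^ j * l) Num.sqrt (w j m / (k ^ j * l)%:R)
     <= C * eta ^+ j) ->
  exists A : set (measurableTypeR R),
    measurable A /\ (@lebesgue_measure R) A = 0%E /\ mu (~` A) = 0%E.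
Proof.
move=> C0 eta01 aff.
pose heavy j m := (k ^ j * l)%:R^-1 < w j m.
pose A j : set (measurableTypeR R) :=
  \big[setU/set0]_(0 <= m < k ^ j * l | heavy j m) cell k l j m.
have mA j : measurable (A j).
  by apply: bigsetU_measurable => m _; exact: measurable_cell.
have mS F : (forall j, measurable (F j)) ->
    measurable (lim_sup_set F : set (measurableTypeR R)).
  by move=> mF; apply: bigcap_measurable => // j _; apply: bigcup_measurable.
(* A minimum is at most the geometric mean: [a] is the length for heavy cells and the mass for light
   ones. *)
have minS (a b : R) : 0 <= a -> a <= b -> a <= Num.sqrt (b * a).
  move=> a0 ab; rewrite -{1}(ger0_norm a0) -sqrtr_sqr.
  by rewrite ler_wsqrtr// expr2 ler_wpM2r.
exists (lim_sup_set A); split; [exact: mS | split].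
  apply: (@lim_sup_set_geometric0 _ _ _ _ _ C eta) => // j.
  apply: le_trans (measure_bigsetU_le _ _ _ _) _; first exact: measurable_cell.
  apply: (@le_trans _ _ (\sum_(0 <= m < k ^ j * l | heavy j m)
      ((k ^ j * l)%:R^-1)%:E)%E).
    by rewrite le_eqVlt; apply/orP; left; apply/eqP; apply: eq_bigr => m _;
      exact: lebesgue_cell.
  rewrite sumEFin lee_fin; apply: le_trans (aff j).
  rewrite big_mkcond/=; apply: ler_sum => m _; case: ifP => hm; last exact: sqrtr_ge0.
  by apply: minS; [rewrite invr_ge0 | exact: ltW].
(* Up to the null set outside [0, 1), [B j] is covered by the light cells of level [j]. *)
pose B j : set (measurableTypeR R) := ~` A j.
have mB j : measurable (B j) by exact: measurableC.
have muB : mu (lim_sup_set B) = 0%E.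
  apply: (@lim_sup_set_geometric0 _ _ _ _ _ C eta) => // j.
  pose D : set (measurableTypeR R) :=
    \big[setU/set0]_(0 <= m < k ^ j * l | ~~ heavy j m) cell k l j m.
  have mD : measurable D.
    by apply: bigsetU_measurable => m _; exact: measurable_cell.
  pose N : set (measurableTypeR R) := ~` `[0, 1[.
  have mN : measurable N.
    exact: measurableC (measurable_itv _).
  apply: (@le_trans _ _ (mu (N `|` D))).
    apply: le_measure; rewrite ?inE//; first exact: measurableU.
    move=> x; rewrite /B /A /D /= -!bigcup_seq_cond => nA.
    have [x01|] := pselect (`[0, 1[%classic x); last by left.
    have [m mk xm] := @cell_cover j x ltac:(by rewrite /= in_itv in x01).
    right; exists m => //=; rewrite mem_index_iota mk/=.
    by apply/negP => hm; apply: nA; exists m => //=; rewrite mem_index_iota mk.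
  apply: le_trans (measureU2 _ mN mD) _; rewrite [X in (X + _)%E]mu_out add0e.
  apply: le_trans (measure_bigsetU_le _ _ _ _) _; first exact: measurable_cell.
  apply: (@le_trans _ _ (\sum_(0 <= m < k ^ j * l | ~~ heavy j m)
      (w j m)%:E)%E).
    rewrite big_seq_cond [leRHS]big_seq_cond; apply: lee_sum => m.
    by rewrite mem_index_iota => /andP[/andP[_ mk] _]; rewrite mu_cell.
  rewrite sumEFin lee_fin; apply: le_trans (aff j).
  rewrite big_mkcond/=; apply: ler_sum => m _; case: ifP => hm; last exact: sqrtr_ge0.
  by rewrite mulrC; apply: minS => //; rewrite leNgt.
apply/eqP; rewrite eq_le measure_ge0 andbT -muB.
apply: le_measure; rewrite ?inE//; [exact: measurableC (mS _ mA) | exact: mS |].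
(* A point outside [lim_sup_set A] lies in [B j] for all [j] from some [n] on. *)
move=> x; rewrite /lim_sup_set setC_bigcap => -[n _] nA i _.
exists (maxn n i); first by rewrite /= leq_maxr.
by move=> Ax; apply: nA; exists (maxn n i) => //=; rewrite leq_maxl.
Qed.

End CellMeasureProperties.

(** * Weak convergence *)

Lemma cvg_sum_nat (R : realType) (n : nat) (f : nat -> nat -> R) (a : nat -> R) :
  (forall m, (m < n)%N -> f m d @[d --> \oo] --> a m) ->
  \sum_(0 <= m < n) f m d @[d --> \oo] --> \sum_(0 <= m < n) a m.
Proof.
elim: n => [|n IH] fa.
  by rewrite big_nil; under eq_fun do rewrite big_nil; exact: cvg_cst.
rewrite big_nat_recr//=; under eq_fun do rewrite big_nat_recr//=.
by apply: cvgD; [apply: IH => m mn; apply: fa; exact: ltnW | exact: fa].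
Qed.

Section CellIntegral.
Context {R : realType} (k l : nat).
Hypothesis (k1 : (1 < k)%N) (l0 : (0 < l)%N).
Variables (w : nat -> nat -> R) (mu : {measure set (measurableTypeR R) -> \bar R}).
Hypothesis wP : mass_distribution k l w.
Hypothesis mu_cell : forall j m, (m < k ^ j * l)%N ->
  mu (cell k l j m) = (w j m)%:E.

Let w_ge0 j m : 0 <= w j m. Proof. by case: wP. Qed.
Let L0 j : 0 < (k ^ j * l)%:R :> R.
Proof. by rewrite ltr0n cells_gt0. Qed.

Lemma integral_cell (g : R -> R) j m (a e : R) : (m < k ^ j * l)%N ->
  continuous g -> 0 <= e -> (forall x, cell k l j m x -> `|g x - a| <= e) ->
  exists2 I : R, (\int[mu]_(x in cell k l j m) (g x)%:E = I%:E)%E &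
    `|I - a * w j m| <= e * w j m.
Proof.
move=> mk cg e0 osc.
pose c : set (measurableTypeR R) := cell k l j m.
have mc : measurable c by exact: measurable_cell.
have muc : mu c = (w j m)%:E by exact: mu_cell.
have mg : measurable_fun c (g : measurableTypeR R -> measurableTypeR R).
  exact: measurable_funS (continuous_measurable_fun cg).
have fc : (mu c < +oo)%E by rewrite [X in (X < _)%E]muc ltry.
have ig : mu.-integrable c (EFin \o g).
  apply: measurable_bounded_integrable => //.
  exists (`|a| + e); split; first exact: num_real.
  move=> M aM x cx; apply: le_trans (ltW aM).
  have := osc x cx; have := ler_normD (g x - a) a; rewrite subrK; lra.
have ia : mu.-integrable c (EFin \o cst a).
  apply: measurable_bounded_integrable => //.
  exists `|a|; split; first exact: num_real.
  by move=> M aM x cx; exact: ltW aM.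
have := integralB_EFin mc ig ia.
have -> : (\int[mu]_(x in c) (cst a x)%:E = (a * w j m)%:E)%E.
  transitivity (a%:E * mu c)%E; last by rewrite [X in (_ * X)%E]muc.
  exact: (@integral_cst _ _ _ mu c mc a%:E).
have fg : (\int[mu]_(x in c) (g x)%:E)%E \is a fin_num by exact: integrable_fin_num ig.
move=> B; exists (fine (\int[mu]_(x in c) (g x)%:E)%E); first by rewrite fineK.
rewrite -lee_fin -abse_EFin EFinB fineK// -B.
apply: le_trans (le_abse_integral _ mc _) _.
  apply: measurableT_comp => //=.
  exact: measurable_funB.
apply: (@le_trans _ _ (e%:E * mu c)%E); last by rewrite [X in (_ * X)%E]muc.
apply: integral_le_bound => //.
  by apply: measurableT_comp => //=; exact: measurable_funB.
by apply: aeW => x cx /=; rewrite lee_fin; exact: osc.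
Qed.

(** The integral is compared with the Riemann sum at left endpoints; as the total mass is 1, an
    oscillation [e] on each cell costs [e] overall. *)
Lemma integral_cells (g : R -> R) j (e : R) : continuous g -> 0 <= e ->
  (forall m x, (m < k ^ j * l)%N -> cell k l j m x ->
     `|g x - g (m%:R / (k ^ j * l)%:R)| <= e) ->
  exists2 I : R, (\int[mu]_(x in `[0%R, 1%R[) (g x)%:E = I%:E)%E &
    `|I - \sum_(0 <= m < k ^ j * l) g (m%:R / (k ^ j * l)%:R) * w j m| <= e.
Proof.
move=> cg e0 osc.
have H m : exists I : R, (m < k ^ j * l)%N ->
    (\int[mu]_(x in cell k l j m) (g x)%:E = I%:E)%E /\
    `|I - g (m%:R / (k ^ j * l)%:R) * w j m| <= e * w j m.
  (* Indices beyond the grid get the default [0], so that choice applies to all [m]. *)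
  have [mk|mk] := ltnP m (k ^ j * l); last by exists 0.
  have [I] := integral_cell mk cg e0 (fun x => osc m x mk).
  by exists I.
have /choice[I IP] := H.
exists (\sum_(0 <= m < k ^ j * l) I m).
  rewrite (itv01_cells k1 l0 j) integral_bigsetU_EFin.
  - rewrite -sumEFin big_seq [RHS]big_seq; apply: eq_bigr => m.
    by rewrite mem_index_iota => /andP[_ mk]; case: (IP m mk).
  - by move=> m; exact: measurable_cell.
  - exact: iota_uniq.
  - by apply: (@sub_trivIset _ _ _ setT) => //; exact: trivIset_cell.
  - apply/measurable_EFinP.
    exact: measurable_funS (continuous_measurable_fun cg).
rewrite -sumrB; apply: le_trans (ler_norm_sum _ _ _) _.
apply: (@le_trans _ _ (\sum_(0 <= m < k ^ j * l) e * w j m)).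
  rewrite big_seq [leRHS]big_seq; apply: ler_sum => m.
  by rewrite mem_index_iota => /andP[_ mk]; case: (IP m mk).
rewrite -mulr_sumr -/(cumulative_mass w j (k ^ j * l)).
by rewrite (cumulative_mass_total wP) mulr1.
Qed.

(** Here [p n m] is the mass at the [m]-th grid point of level [n]. At a fixed coarse level [j], the
    integral is close to its Riemann sum [S]; replacing [w j m] by the masses that [p n] gives to
    the cells changes [S] into the nearby [S']; and [S'] is close to the fine sum by the oscillation
    bound again. *)
Lemma cell_weak_convergence (p : nat -> nat -> R) (g : R -> R) :
  (forall n m, 0 <= p n m) ->
  (forall n, \sum_(0 <= m < k ^ n * l) p n m = 1) ->
  (forall j m, (m < k ^ j * l)%N ->
     \sum_(0 <= r < k ^ d) p (j + d)%N (k ^ d * m + r)%N @[d --> \oo] --> w j m) ->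
  continuous g ->
  (\sum_(0 <= m < k ^ n * l) p n m * g (m%:R / (k ^ n * l)%:R))%:E @[n --> \oo]
    --> (\int[mu]_(x in `[0%R, 1%R[) (g x)%:E)%E.
Proof.
move=> p0 p1 pw cg.
have osc (e : R) : 0 < e -> exists j, forall m x, (m < k ^ j * l)%N ->
    cell k l j m x -> `|g x - g (m%:R / (k ^ j * l)%:R)| <= e.
  move=> e0; have [d d0 dP] := segment_uniform_continuity cg e0.
  have [j jd] : exists j, d^-1 < (k ^ j * l)%:R.
    exists (Num.truncn d^-1).+1; rewrite -truncn_lt_nat ?invr_ge0 ?ltW//.
    apply: leq_trans (leq_pmulr _ l0).
    by apply: ltn_trans (ltn_expl _ k1).
  exists j => m x mk cx; apply: ltW; apply: dP.
    have := cell_sub01 k1 l0 mk cx; rewrite /= in_itv/= => /andP[-> /ltW]//.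
  move: cx; rewrite /cell/= in_itv/= => /andP[h1 h2].
  rewrite ger0_norm ?subr_ge0// ltrBlDl; apply: lt_trans h2 _.
  rewrite -natr1 mulrDl mul1r ltrD2l -[ltRHS]invrK ltf_pV2 ?posrE ?invr_gt0//.
(* The tolerance [1] serves only to show that the integral is a real number. *)
have [j1 H1] := osc 1 ltr01.
have [I IE _] := integral_cells cg ler01 H1.
rewrite IE; apply: cvg_EFin; first exact: nearW.
apply/cvgrPdist_lt => e e0.
(* Three errors of at most [e / 4] stay below [e]. *)
have e40 : 0 < e / 4 by rewrite divr_gt0.
have [j Hj] := osc _ e40.
have [I' IE' I'e] := integral_cells cg (ltW e40) Hj.
have {IE' I'}I'e :
    `|I - \sum_(0 <= m < k ^ j * l) g (m%:R / (k ^ j * l)%:R) * w j m| <= e / 4.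
  by move: IE'; rewrite IE => -[->].
have cvgS : \sum_(0 <= m < k ^ j * l) g (m%:R / (k ^ j * l)%:R) *
      (\sum_(0 <= r < k ^ d) p (j + d)%N (k ^ d * m + r)%N) @[d --> \oo]
    --> \sum_(0 <= m < k ^ j * l) g (m%:R / (k ^ j * l)%:R) * w j m.
  by apply: cvg_sum_nat => m mk; apply: cvgM; [exact: cvg_cst | exact: pw].
have /cvgrPdist_lt /(_ _ e40) [D _ DP] := cvgS.
exists (j + D)%N => // n /= jn.
have {jn} [d Dd ->] : exists2 d, (D <= d)%N & n = (j + d)%N.
  by exists (n - j)%N; lia.
have := DP d Dd => /=.
set S := \sum_(0 <= m < _) _ * w j m in I'e *; set S' := \sum_(0 <= m < _) _.
move=> SS'.
suff : `|S' - \sum_(0 <= m < k ^ (j + d) * l)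
    p (j + d)%N m * g (m%:R / (k ^ (j + d) * l)%:R)| <= e / 4.
  set S'' := \sum_(0 <= m < k ^ (j + d) * l) _ => S'S''.
  have := ler_distD S I S''; have := ler_distD S' S S''; lra.
have kd0 : (0 < k ^ d)%N by rewrite expn_gt0 (ltnW k1).
have LE : (k ^ (j + d) * l = k ^ d * (k ^ j * l))%N.
  by rewrite expnD mulnAC mulnC mulnA.
(* The bound [e / 4] is spread over the grid points with weights [p], so that it can be checked term
   by term. *)
have <- : \sum_(0 <= m < k ^ j * l) \sum_(0 <= r < k ^ d)
    e / 4 * p (j + d)%N (k ^ d * m + r)%N = e / 4.
  under eq_bigr do rewrite -mulr_sumr.
  by rewrite -mulr_sumr -sum_nat_block -LE p1 mulr1.
rewrite /S' LE (sum_nat_block (k ^ d)%N) -sumrB; apply: le_trans (ler_norm_sum _ _ _) _.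
rewrite big_seq [leRHS]big_seq; apply: ler_sum => m.
rewrite mem_index_iota => /andP[_ mk].
rewrite mulr_sumr -sumrB; apply: le_trans (ler_norm_sum _ _ _) _.
rewrite big_seq [leRHS]big_seq; apply: ler_sum => r.
rewrite mem_index_iota => /andP[_ rk].
rewrite mulrC -mulrBr normrM ger0_norm// mulrC; apply: ler_wpM2r => //.
rewrite distrC; apply: Hj => //; apply/(cellE k1 l0).
have kd0R : 0 < (k ^ d)%:R :> R by rewrite ltr0n.
have -> : (k ^ d * m + r)%:R / (k ^ d * (k ^ j * l))%:R * (k ^ j * l)%:R =
    (k ^ d * m + r)%:R / (k ^ d)%:R :> R.
  rewrite (natrM _ (k ^ d)%N (k ^ j * l)%N).
  move: (L0 j) kd0R; move: ((k ^ j * l)%:R : R) ((k ^ d)%:R : R) => a b a0 b0.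
  by field; rewrite !gt_eqF.
rewrite ler_pdivlMr// ltr_pdivrMr// -!natrM ler_nat ltr_nat mulSn.
by rewrite mulnC leq_addr addnC ltn_add2r.
Qed.

End CellIntegral.

(** * Contraction and affinity *)

Section Affinity.
Context {R : realType}.

(** With p_i = x_i / X, q_i the root of p_i and c the root of 1/k, the normalized affinity is 1
    minus half the sum of (q_i - c)^2. The first and last terms add up to at least (q_{k-1} - q_0)^2
    / 2, hence to delta^2 / 8, whence the 1/16. *)
Lemma affinity_le (k : nat) (x : nat -> R) (X delta : R) : (1 < k)%N ->
  (forall i, 0 <= x i) -> \sum_(0 <= i < k) x i = X -> 0 < X -> 0 <= delta ->
  delta * X <= x k.-1 - x 0%N ->
  \sum_(0 <= i < k) Num.sqrt (x i / k%:R) <= (1 - delta ^+ 2 / 16) * Num.sqrt X.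
Proof.
move=> k1 x0 xX X0 d0 dX.
have k0 : 0 < k%:R :> R by rewrite ltr0n ltnW.
pose p i := x i / X.
have p0 i : 0 <= p i by rewrite divr_ge0// ltW.
have p1 : \sum_(0 <= i < k) p i = 1 by rewrite -mulr_suml xX divff ?gt_eqF.
pose q i := Num.sqrt (p i); pose c := Num.sqrt (k%:R^-1 : R).
have qq i : q i ^+ 2 = p i by rewrite sqr_sqrtr.
have cc : c ^+ 2 = k%:R^-1 by rewrite sqr_sqrtr// invr_ge0 ltW.
have -> : \sum_(0 <= i < k) Num.sqrt (x i / k%:R) =
    Num.sqrt X * \sum_(0 <= i < k) q i * c.
  rewrite mulr_sumr; apply: eq_bigr => i _.
  rewrite /q /c -sqrtrM// -sqrtrM ?ltW//; congr (Num.sqrt _).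
  by rewrite /p; field; rewrite !gt_eqF.
rewrite mulrC; apply: ler_wpM2r; first exact: sqrtr_ge0.
have -> : \sum_(0 <= i < k) q i * c =
    1 - 2^-1 * \sum_(0 <= i < k) (q i - c) ^+ 2.
  transitivity (1 - 2^-1 * \sum_(0 <= i < k) (p i + k%:R^-1 - 2 * (q i * c))).
    rewrite sumrB big_split/= p1 sumr_const_nat subn0 -mulr_sumr.
    by rewrite -[k%:R^-1 *+ k]mulr_natr mulVf ?gt_eqF//; field.
  congr (1 - _ * _); apply: eq_bigr => i _.
  by rewrite -qq -cc; ring.
have pl1 i : (i < k)%N -> p i <= 1.
  move=> ik; rewrite -p1 (big_cat_nat (leq0n i) (ltnW ik))/= (big_ltn ik).
  by rewrite addrCA lerDl addr_ge0//; exact: sumr_ge0.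
have ql1 i : (i < k)%N -> q i <= 1.
  by move=> ik; rewrite -(sqrtr1 R) ler_wsqrtr// pl1.
have kk : (k.-1 < k)%N by lia.
have two : (q k.-1 - c) ^+ 2 + (q 0%N - c) ^+ 2 <= \sum_(0 <= i < k) (q i - c) ^+ 2.
  rewrite (big_ltn (ltnW k1)) addrC lerD2l.
  rewrite [X in \sum_(1 <= _ < X) _](_ : k = k.-1.+1); last by lia.
  rewrite big_nat_recr /=; last by lia.
  by rewrite lerDr sumr_ge0// => i _; exact: sqr_ge0.
have dq : delta / 2 <= q k.-1 - q 0%N.
  have dp : delta <= q k.-1 ^+ 2 - q 0%N ^+ 2.
    by rewrite !qq -mulrBl ler_pdivlMr.
  have qk := ql1 _ kk; have q0 := ql1 0%N (ltnW k1).
  have qq0 : q 0%N <= q k.-1.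
    by apply: ler_wsqrtr; rewrite -subr_ge0 -!qq; lra.
  (* As both roots are at most 1, their squares differ by at most twice their difference. *)
  have : 0 <= (q k.-1 - q 0%N) * (2 - q k.-1 - q 0%N) by apply: mulr_ge0; lra.
  by lra.
have d4 : delta ^+ 2 / 4 <= (q k.-1 - q 0%N) ^+ 2.
  have -> : delta ^+ 2 / 4 = (delta / 2) ^+ 2 by field.
  by rewrite ler_sqr ?nnegrE; lra.
(* This square gives a^2 + b^2 >= (a - b)^2 / 2 for the two deviations a, b from [c]. *)
have := sqr_ge0 (q k.-1 - c + (q 0%N - c)); lra.
Qed.

Section Consistent.
Variables (k l : nat) (w : nat -> nat -> R).
Hypothesis (k1 : (1 < k)%N) (l0 : (0 < l)%N) (wP : mass_distribution k l w).

(** By induction [w j m <= theta ^+ j]; the masses of level 0 are at most 1 because they sum to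
    1. *)
Lemma vanishing_mass_contraction (theta : R) : 0 <= theta < 1 ->
  (forall j m i, (i < k)%N -> w j.+1 (k * m + i)%N <= theta * w j m) ->
  vanishing_mass k l w.
Proof.
move=> /andP[t0 t1] wt.
have [w0 _ w1] := wP.
have wle j m : (m < k ^ j * l)%N -> w j m <= theta ^+ j.
  elim: j m => [|j IH] m mk.
    have ml : (m < l)%N by move: mk; rewrite mul1n.
    rewrite expr0 -w1 (big_cat_nat (leq0n m) (ltnW ml))/= (big_ltn ml).
    by rewrite addrCA lerDl addr_ge0//; exact: sumr_ge0.
  rewrite (divn_eq m k) mulnC exprS.
  apply: le_trans (wt _ _ _ _) _; first by rewrite ltn_mod ltnW.
  by apply: ler_wpM2l => //; apply: IH; rewrite ltn_divLR ?(ltnW k1)// mulnAC -expnSr.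
move=> e e0.
have tc : (fun j => theta ^+ j) @ \oo --> (0 : R).
  by apply: cvg_expr; rewrite ger0_norm.
move/cvgrPdist_lt : tc => /(_ e e0) [N _ NP]; exists N => // j /NP/=.
rewrite sub0r normrN ger0_norm ?exprn_ge0// => tj m mk.
exact: le_lt_trans (wle j m mk) tj.
Qed.

(** A child is [k] times shorter than its parent, so the sum over the children of a cell is the root
    of the parent's length times the sum in the hypothesis. *)
Lemma affinity_decay (eta : R) : 0 <= eta ->
  (forall j m, \sum_(0 <= i < k) Num.sqrt (w j.+1 (k * m + i)%N / k%:R)
     <= eta * Num.sqrt (w j m)) ->
  forall j, \sum_(0 <= m < k ^ j * l) Num.sqrt (w j m / (k ^ j * l)%:R) <=
    (\sum_(0 <= m < l) Num.sqrt (w 0 m / l%:R)) * eta ^+ j.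
Proof.
move=> e0 we; have [w0 _ _] := wP.
elim=> [|j IH]; first by rewrite expr0 mulr1 mul1n.
rewrite exprSr mulrA; apply: le_trans (ler_wpM2r e0 IH).
rewrite expnS -mulnA sum_nat_block mulr_suml; apply: ler_sum => m _.
rewrite natrM; under eq_bigr => i _.
  rewrite invfM mulrA sqrtrM ?divr_ge0//; over.
rewrite -mulr_suml sqrtrM// mulrAC mulrC [leRHS]mulrC; apply: ler_wpM2l.
  exact: sqrtr_ge0.
by rewrite mulrC; exact: we.
Qed.

End Consistent.
End Affinity.

(** * The Zaremba sequence *)

Section Zaremba.
Variable k : nat.
Hypothesis k1 : (1 < k)%N.

(** The recursive call keeps the fuel of the predecessor, whereas [zaremba] takes the number itself
    as fuel. *)
Lemma zprod_fuel f m : (m <= f)%N -> zprod k f m = zprod k m m.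
Proof.
elim/ltn_ind: m f => -[|m] IH [|f] //= mf.
have lt : (m.+1 %/ k <= m)%N by rewrite -ltnS ltn_Pdiv.
by rewrite (IH _ lt) ?(IH _ lt m lt)// (leq_trans lt).
Qed.

(** Positivity excludes [m = i = 0], where [zprod] is the identity and not [Bmat 0]. *)
Lemma zprod_digit m i : (i < k)%N -> (0 < k * m + i)%N ->
  zprod k (k * m + i) (k * m + i) = zprod k m m *m Bmat i.
Proof.
move=> ik; have : ((k * m + i) %/ k = m)%N.
  by rewrite mulnC divnMDl ?divn_small ?addn0// ltnW.
have : ((k * m + i) %% k = i)%N by rewrite mulnC modnMDl modn_small.
move: (k * m + i)%N => [//|n] nk nm _ /=.
rewrite nk nm zprod_fuel// -nm -ltnS ltn_Pdiv//.
Qed.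

(** Together with [zaremba k m] this is the first row (a, b) of the digit product; appending the
    digit [i] sends it to ((i + 1) a + b, a). *)
Definition zaremba_snd (m : nat) : int := zprod k m m 0 1.

Lemma zarembaE m : zaremba k m = zprod k m m 0 0.
Proof.
by rewrite /zaremba !mxE !big_ord_recl !big_ord0 !mxE/= !big_ord_recl !big_ord0 !mxE/=;
  rewrite !mul1r !mul0r !mulr1 !mulr0 !addr0.
Qed.

Lemma zaremba_digit m i : (i < k)%N -> (0 < k * m + i)%N ->
  zaremba k (k * m + i) = i.+1%:Z * zaremba k m + zaremba_snd m.
Proof.
move=> ik mi; rewrite !zarembaE zprod_digit// /zaremba_snd.
rewrite !mxE !big_ord_recl !big_ord0 !mxE/= mulr1 addr0 mulrC.
by congr (_ + zprod _ _ _ _ _); apply: val_inj.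
Qed.

Lemma zaremba_snd_digit m i : (i < k)%N -> (0 < k * m + i)%N ->
  zaremba_snd (k * m + i) = zaremba k m.
Proof.
move=> ik mi; rewrite /zaremba_snd zprod_digit// zarembaE.
by rewrite !mxE !big_ord_recl !big_ord0 !mxE/= mulr1 mulr0 !addr0.
Qed.

(** Appending a digit preserves these inequalities. They make the weights positive and later bound
    from below the gap between the last and the first child. *)
Lemma zaremba_bounds m : 0 <= zaremba_snd m <= zaremba k m /\ 0 < zaremba k m.
Proof.
elim/ltn_ind: m => -[|m] IH.
  by rewrite zarembaE /zaremba_snd !mxE.
have ik : (m.+1 %% k < k)%N by rewrite ltn_mod ltnW.
have mE : (m.+1 = k * (m.+1 %/ k) + m.+1 %% k)%N by rewrite mulnC -divn_eq.
have [/andP[b0 ba] a0] := IH _ (ltn_Pdiv k1 (ltn0Sn m)).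
have m0 : (0 < k * (m.+1 %/ k) + m.+1 %% k)%N by rewrite -mE.
have := zaremba_digit ik m0; have := zaremba_snd_digit ik m0; rewrite -mE => -> ->.
have le : zaremba k (m.+1 %/ k)%N <= (m.+1 %% k).+1%:Z * zaremba k (m.+1 %/ k)%N.
  by rewrite ler_peMl// ltW.
by rewrite ltW//=; lia.
Qed.

End Zaremba.

Lemma SigmaE (R : realType) (f : nat -> int) (k n : nat) :
  Sigma f k n = \sum_(0 <= m < k ^ n * (k - 1)) (f (k ^ n + m)%N)%:~R :> R.
Proof.
rewrite /Sigma -{1}(add0n (k ^ n)%N) big_addn expnSr mulnBr muln1.
by apply: eq_bigr => m _; rewrite addnC.
Qed.

(** * Descendant sums and limiting cell masses *)

Section ZarembaSums.
Context {R : realType}.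
Variable k : nat.
Hypothesis k1 : (1 < k)%N.

(* For an eigenvalue t of B_0 + ... + B_(k-1) with eigenvector (t, k), this is
   e_1^T B_(i_s) ... B_(i_0) (t, k)^T for the base-k digits i_s ... i_0 of m. *)
Definition zaremba_eigen (t : R) (m : nat) : R :=
  (zaremba k m)%:~R * t + (zaremba_snd k m)%:~R * k%:R.

(** The trace of B; the determinant is -k^2, so the equation t^2 = [digit_trace] t + k^2 is the
    characteristic one. *)
Definition digit_trace : R := \sum_(0 <= i < k) i.+1%:R.

Let k0R : 0 < k%:R :> R. Proof. by rewrite ltr0n ltnW. Qed.

Lemma zaremba_eigen_digit t m i : (0 < m)%N -> (i < k)%N ->
  zaremba_eigen t (k * m + i) =
  (i.+1%:R * (zaremba k m)%:~R + (zaremba_snd k m)%:~R) * t + (zaremba k m)%:~R * k%:R.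
Proof.
move=> m0 ik; have mi : (0 < k * m + i)%N by rewrite addn_gt0 muln_gt0 (ltnW k1) m0.
by rewrite /zaremba_eigen zaremba_digit// zaremba_snd_digit// rmorphD rmorphM.
Qed.

(** This is B v = t v for v = (t, k)^T, multiplied on the left by the row of [m]. *)
Lemma zaremba_eigen_sum t m : t ^+ 2 = digit_trace * t + k%:R ^+ 2 -> (0 < m)%N ->
  \sum_(0 <= i < k) zaremba_eigen t (k * m + i) = t * zaremba_eigen t m.
Proof.
move=> tE m0.
transitivity (\sum_(0 <= i < k) (i.+1%:R * ((zaremba k m)%:~R * t) +
    ((zaremba_snd k m)%:~R * t + (zaremba k m)%:~R * k%:R)) : R).
  rewrite big_seq [RHS]big_seq; apply: eq_bigr => i.
  by rewrite mem_index_iota => /andP[_ ik]; rewrite zaremba_eigen_digit//; ring.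
rewrite big_split/= -mulr_suml -/digit_trace sumr_const_nat subn0 -[_ *+ k]mulr_natr.
rewrite /zaremba_eigen.
have -> : t * ((zaremba k m)%:~R * t + (zaremba_snd k m)%:~R * k%:R) =
   (zaremba k m)%:~R * t ^+ 2 + (zaremba_snd k m)%:~R * k%:R * t by ring.
by rewrite tE; ring.
Qed.

Variables rho sigma : R.
Hypothesis rhoE : rho ^+ 2 = digit_trace * rho + k%:R ^+ 2.
Hypothesis sigmaE : sigma ^+ 2 = digit_trace * sigma + k%:R ^+ 2.
Hypothesis rho_sigma : `|sigma| < rho.

Let rho0 : 0 < rho. Proof. exact: le_lt_trans rho_sigma. Qed.
Let rho_neq : rho - sigma != 0.
Proof. by rewrite gt_eqF// subr_gt0 (le_lt_trans (ler_norm _)). Qed.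

(** For [d = 0] the second components, equal to [k] in both eigenvectors, cancel in the difference.
    The induction splits off the digit next to [m] and multiplies each weight by its eigenvalue. *)
Lemma zaremba_descendants_sum d m : (0 < m)%N ->
  \sum_(0 <= r < k ^ d) (zaremba k (k ^ d * m + r))%:~R =
  (rho ^+ d * zaremba_eigen rho m - sigma ^+ d * zaremba_eigen sigma m)
    / (rho - sigma).
Proof.
elim: d m => [|d IH] m m0.
  by rewrite big_nat1 mul1n addn0 !expr0 /zaremba_eigen; field.
rewrite expnSr sum_nat_block.
transitivity (\sum_(0 <= i < k) (rho ^+ d * zaremba_eigen rho (k * m + i) -
    sigma ^+ d * zaremba_eigen sigma (k * m + i)) / (rho - sigma)).
  apply: eq_bigr => i _; rewrite -IH; last by rewrite addn_gt0 muln_gt0 (ltnW k1) m0.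
  by apply: eq_bigr => r _; rewrite addnA mulnDr mulnA.
rewrite -mulr_suml sumrB -!mulr_sumr !zaremba_eigen_sum//.
by rewrite !mulrA -!exprSr.
Qed.

Lemma zaremba_eigen_gt0 m : 0 < zaremba_eigen rho m.
Proof.
have [/andP[b0 ba] a0] := zaremba_bounds k1 m.
by rewrite /zaremba_eigen ltr_pwDl// ?mulr_gt0 ?mulr_ge0 ?ltr0z ?ler0z// ltW.
Qed.

(** The sum runs over the nonzero leading digits, that is, over the cells of level 0. *)
Definition ghost_norm (t : R) : R := \sum_(0 <= i < k - 1) zaremba_eigen t i.+1.

(** The shift by [k ^ j] respects children: k (k^j + m) + i = k^(j+1) + (k m + i). *)
Definition ghost_mass (j m : nat) : R :=
  zaremba_eigen rho (k ^ j + m) / (rho ^+ j * ghost_norm rho).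

Lemma Sigma_zaremba n : Sigma (zaremba k) k n =
  (rho ^+ n * ghost_norm rho - sigma ^+ n * ghost_norm sigma) / (rho - sigma).
Proof.
rewrite SigmaE sum_nat_block.
transitivity (\sum_(0 <= i < k - 1) (rho ^+ n * zaremba_eigen rho i.+1 -
    sigma ^+ n * zaremba_eigen sigma i.+1) / (rho - sigma)).
  apply: eq_bigr => i _; rewrite -zaremba_descendants_sum//.
  by apply: eq_bigr => r _; rewrite mulnS addnA.
by rewrite -mulr_suml sumrB -!mulr_sumr.
Qed.

Lemma ghost_norm_gt0 : 0 < ghost_norm rho.
Proof.
rewrite /ghost_norm big_ltn ?subn_gt0//.
rewrite ltr_pwDl ?zaremba_eigen_gt0//.
by apply: sumr_ge0 => i _; exact/ltW/zaremba_eigen_gt0.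
Qed.

Let norm0 := ghost_norm_gt0.

Lemma ghost_mass_distribution : mass_distribution k (k - 1) ghost_mass.
Proof.
split=> [j m|j m|].
- by rewrite /ghost_mass divr_ge0 ?mulr_ge0 ?exprn_ge0 ?ltW ?zaremba_eigen_gt0.
- have M0 : (0 < k ^ j + m)%N by rewrite addn_gt0 expn_gt0 (ltnW k1).
  rewrite /ghost_mass -mulr_suml; under eq_bigr do rewrite expnS addnA -mulnDr.
  rewrite zaremba_eigen_sum// exprS; field.
  by rewrite !gt_eqF// exprn_gt0.
- rewrite /ghost_mass -mulr_suml expr0 mul1r.
  by rewrite -/(ghost_norm rho) divff ?gt_eqF.
Qed.


Lemma ghost_massS j m i :
  ghost_mass j.+1 (k * m + i) =
  zaremba_eigen rho (k * (k ^ j + m) + i) / (rho * (rho ^+ j * ghost_norm rho)).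
Proof. by rewrite /ghost_mass expnS exprS addnA -mulnDr mulrA. Qed.

Lemma rho_gt1 : 1 < rho.
Proof.
have k1R : 1 < k%:R :> R by rewrite ltr1n.
have s0 : 0 <= digit_trace by apply: sumr_ge0 => i _; exact: ler0n.
have sr : 0 <= digit_trace * rho by rewrite mulr_ge0// ltW.
rewrite ltNge; apply/negP => r1.
have : rho ^+ 2 <= 1 by rewrite expr_le1// ltW.
have : 1 < k%:R ^+ 2 :> R by rewrite exprn_egt1.
by rewrite rhoE; lra.
Qed.

Lemma zaremba_eigen_digit_ge m i : (0 < m)%N -> (i < k)%N ->
  zaremba_eigen rho m <= zaremba_eigen rho (k * m + i).
Proof.
move=> m0 ik; rewrite zaremba_eigen_digit// /zaremba_eigen.
have [/andP[b0 ba] a0] := zaremba_bounds k1 m.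
apply: lerD.
  apply: ler_wpM2r; first exact: ltW.
  rewrite -natr1 mulrDl mul1r -addrA addrCA lerDl addr_ge0 ?mulr_ge0 ?ler0z//.
  exact: ltW.
by apply: ler_wpM2r; rewrite ?ler_int// ltW.
Qed.

(* Every sibling of a child has weight at least W(m), so the child itself gets
   at most (rho - 1) W(m) out of the total rho W(m). *)
Lemma zaremba_eigen_digit_le m i : (0 < m)%N -> (i < k)%N ->
  zaremba_eigen rho (k * m + i) <= (rho - 1) * zaremba_eigen rho m.
Proof.
move=> m0 ik.
(* One sibling suffices, and [k >= 2] provides it. *)
pose i' := if i == 0%N then 1%N else 0%N.
have i'k : (i' < k)%N by rewrite /i'; case: eqP => // _; exact: ltnW.
have ii' : i' != i by rewrite /i'; have [->|i0] := eqVneq i 0%N; rewrite // eq_sym.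
rewrite mulrBl mul1r lerBrDr -(zaremba_eigen_sum rhoE m0).
apply: le_trans (lerD (lexx _) (zaremba_eigen_digit_ge m0 i'k)) _.
rewrite big_mkord (bigD1 (Ordinal ik))//= (bigD1 (Ordinal i'k))/=; last first.
  by rewrite -val_eqE.
rewrite addrA lerDl; apply: sumr_ge0 => n _; exact/ltW/zaremba_eigen_gt0.
Qed.

Lemma ghost_mass_vanishing : vanishing_mass k (k - 1) ghost_mass.
Proof.
have r1 := rho_gt1.
apply: (vanishing_mass_contraction k1 ghost_mass_distribution
  (theta := (rho - 1) / rho)).
  by rewrite divr_ge0 ?subr_ge0 ?ltW//= ltr_pdivrMr// mul1r; lra.
move=> j m i ik; rewrite ghost_massS /ghost_mass.
have D0 : 0 < rho ^+ j * ghost_norm rho by rewrite mulr_gt0// exprn_gt0.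
rewrite mulf_div ler_pM2r ?invr_gt0 ?mulr_gt0 ?exprn_gt0//.
by apply: zaremba_eigen_digit_le => //; rewrite addn_gt0 expn_gt0 (ltnW k1).
Qed.

Lemma ghost_mass_affinity : exists2 eta : R, 0 <= eta < 1 &
  forall j m, \sum_(0 <= i < k) Num.sqrt (ghost_mass j.+1 (k * m + i) / k%:R)
    <= eta * Num.sqrt (ghost_mass j m).
Proof.
have l0 : 0 < k%:R - 1 :> R by rewrite subr_gt0 ltr1n.
(* For a parent with row (a, b), the last and first children differ in weight by (k - 1) rho a, out
   of a total of rho (a rho + b k); since b <= a, the ratio is at least [delta]. *)
pose delta := (k%:R - 1) / (rho + k%:R).
have rk : 0 < rho + k%:R by rewrite addr_gt0.
have d0 : 0 < delta by rewrite divr_gt0.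
have d1 : delta <= 1 by rewrite ler_pdivrMr// mul1r; have := rho0; lra.
exists (1 - delta ^+ 2 / 16).
  have dd1 : delta ^+ 2 <= 1 by rewrite expr_le1// ltW.
  have dd0 : 0 < delta ^+ 2 by rewrite exprn_gt0.
  by apply/andP; split; lra.
move=> j m; have [w0 wS _] := ghost_mass_distribution.
have M0 : (0 < k ^ j + m)%N by rewrite addn_gt0 expn_gt0 (ltnW k1).
have D0 : 0 < rho * (rho ^+ j * ghost_norm rho) by rewrite !mulr_gt0// exprn_gt0.
apply: affinity_le => //; last 2 first.
- exact: ltW.
- rewrite !ghost_massS -mulrBl ler_pdivlMr//.
  have -> : delta * ghost_mass j m * (rho * (rho ^+ j * ghost_norm rho)) =
     delta * rho * zaremba_eigen rho (k ^ j + m).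
    by rewrite /ghost_mass; field; rewrite !gt_eqF// exprn_gt0.
  rewrite !zaremba_eigen_digit ?(ltnW k1)//; last by rewrite prednK ?(ltnW k1).
  rewrite prednK ?(ltnW k1)//.
  have [/andP[b0 ba] a0] := zaremba_bounds k1 (k ^ j + m).
  rewrite /zaremba_eigen /delta.
  have : (zaremba_snd k (k ^ j + m))%:~R <= (zaremba k (k ^ j + m))%:~R :> R.
    by rewrite ler_int.
  move: ((zaremba_snd k (k ^ j + m))%:~R : R) ((zaremba k (k ^ j + m))%:~R : R).
  move=> b a ba'.
  have -> : (k%:R * a + b) * rho + a * k%:R - ((1%:R * a + b) * rho + a * k%:R) =
     (k%:R - 1) * rho * a by ring.
  have -> : (k%:R - 1) / (rho + k%:R) * rho * (a * rho + b * k%:R) =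
     (k%:R - 1) * rho * ((a * rho + b * k%:R) / (rho + k%:R)).
    by field; rewrite gt_eqF.
  rewrite ler_pM2l ?mulr_gt0// ler_pdivrMr// mulrDr lerD2l.
  by apply: ler_wpM2r => //; exact: ltW.
- by rewrite /ghost_mass divr_gt0 ?zaremba_eigen_gt0// mulr_gt0// exprn_gt0.
Qed.

Lemma zaremba_cell_cvg j m :
  \sum_(0 <= r < k ^ d) (zaremba k (k ^ (j + d) + (k ^ d * m + r)))%:~R /
    Sigma (zaremba k) k (j + d) @[d --> \oo] --> ghost_mass j m.
Proof.
have M0 : (0 < k ^ j + m)%N by rewrite addn_gt0 expn_gt0 (ltnW k1).
have rX n : 0 < rho ^+ n by rewrite exprn_gt0.
(* Dividing numerator and denominator by [rho ^+ d] leaves only powers of [t], which tend to 0. *)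
pose t := sigma / rho.
have tc : (fun d => t ^+ d) @ \oo --> (0 : R).
  by apply: cvg_expr; rewrite normrM normfV [`|rho|]gtr0_norm// ltr_pdivrMr// mul1r.
have -> : (fun d => \sum_(0 <= r < k ^ d)
      (zaremba k (k ^ (j + d) + (k ^ d * m + r)))%:~R / Sigma (zaremba k) k (j + d)) =
  (fun d => (zaremba_eigen rho (k ^ j + m) - t ^+ d * zaremba_eigen sigma (k ^ j + m)) /
     (rho ^+ j * ghost_norm rho - sigma ^+ j * t ^+ d * ghost_norm sigma) : R).
  apply/funext => d; rewrite -mulr_suml.
  under eq_bigr do rewrite expnD addnA (mulnC (k ^ j)%N) -mulnDr.
  rewrite zaremba_descendants_sum// Sigma_zaremba.
  have cancel (x a b : R) : x != 0 -> x * a / (x * b) = a / b.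
    by move=> x0; rewrite invfM mulrACA divff// mul1r.
  rewrite ![_ / (rho - sigma)]mulrC cancel ?invr_eq0//.
  have -> : sigma = t * rho by rewrite /t divfK ?gt_eqF.
  rewrite -(cancel (rho ^+ d) (_ - t ^+ d * _)) ?gt_eqF//.
  by congr (_ / _); rewrite ?exprD ?exprMn; ring.
rewrite /ghost_mass -[X in _ --> X]/(_ / _).
have -> : zaremba_eigen rho (k ^ j + m) / (rho ^+ j * ghost_norm rho) =
    (zaremba_eigen rho (k ^ j + m) - 0 * zaremba_eigen sigma (k ^ j + m)) /
    (rho ^+ j * ghost_norm rho - sigma ^+ j * 0 * ghost_norm sigma).
  by rewrite mulr0 !mul0r !subr0.
apply: cvgM.
  by apply: cvgB; [exact: cvg_cst | apply: cvgM; [exact: tc | exact: cvg_cst]].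
apply: cvgV; first by rewrite mulr0 mul0r subr0 mulf_neq0 ?gt_eqF.
apply: cvgB; first exact: cvg_cst.
by apply: cvgM; [apply: cvgM; [exact: cvg_cst | exact: tc] | exact: cvg_cst].
Qed.

End ZarembaSums.

(** * Eigenvalues and conclusion *)

Lemma zaremba_eigenvalues_exist (R : realType) (k : nat) : (1 < k)%N ->
  exists rho sigma : R, [/\ rho ^+ 2 = digit_trace k * rho + k%:R ^+ 2,
    sigma ^+ 2 = digit_trace k * sigma + k%:R ^+ 2 & `|sigma| < rho].
Proof.
move=> k1; pose s : R := digit_trace k.
have s0 : 0 < s.
  rewrite /s /digit_trace big_ltn ?(ltnW k1)// ltr_pwDl//.
  by apply: sumr_ge0 => i _; exact: ler0n.
have sk0 : 0 < s ^+ 2 + 4 * k%:R ^+ 2.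
  have := sqr_ge0 (k%:R : R); have : 0 < s ^+ 2 by rewrite exprn_gt0.
  by lra.
pose D := Num.sqrt (s ^+ 2 + 4 * k%:R ^+ 2).
have DD : D ^+ 2 = s ^+ 2 + 4 * k%:R ^+ 2.
  by rewrite sqr_sqrtr// ltW.
have D0 : 0 < D.
  by rewrite sqrtr_gt0.
exists ((s + D) / 2), ((s - D) / 2); rewrite -/s; split.
- have -> : ((s + D) / 2) ^+ 2 = (s ^+ 2 + 2 * s * D + D ^+ 2) / 4 by field.
  by rewrite DD; field.
- have -> : ((s - D) / 2) ^+ 2 = (s ^+ 2 - 2 * s * D + D ^+ 2) / 4 by field.
  by rewrite DD; field.
- by rewrite ltr_norml; apply/andP; split; lra.
Qed.

Theorem theorem7 (R : realType) (k : nat) (hk : (2 <= k)%N) :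
  exists mu : {measure set (measurableTypeR R) -> \bar R},
    is_ghost_measure (zaremba k) k mu /\ singular_continuous mu.
Proof.
have l0 : (0 < k - 1)%N by rewrite subn_gt0.
have [rho [sigma [rhoE sigmaE rho_sigma]]] := zaremba_eigenvalues_exist R hk.
have wP := ghost_mass_distribution hk rhoE rho_sigma.
have wv := ghost_mass_vanishing hk rhoE rho_sigma.
have [mu [mu1 mu_out mu_cell]] := cell_measure_exists hk l0 wP wv.
exists mu; split; [split=> //; split=> // | split].
- move=> g [cg _].
  (* The mass that mu_n gives to its [m]-th support point. *)
  pose p n m : R := (zaremba k (k ^ n + m))%:~R / Sigma (zaremba k) k n.
  have z0 m : 0 < (zaremba k m)%:~R :> R.
    by rewrite ltr0z; case: (zaremba_bounds hk m).
  have S0 n : 0 < Sigma (zaremba k) k n :> R.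
    rewrite SigmaE big_ltn ?muln_gt0 ?expn_gt0 ?(ltnW hk)// ltr_pwDl//.
    by apply: sumr_ge0 => m _; exact: ltW.
  have := @cell_weak_convergence R k _ hk l0 _ mu wP mu_cell p g.
  rewrite (_ : (fun n => _) = (fun n => (mu_n_integral (zaremba k) k n g)%:E)).
    apply=> //.
    + by move=> n m; rewrite divr_ge0// ltW.
    + by move=> n; rewrite -mulr_suml -SigmaE divff// gt_eqF.
    + move=> j m _.
      have := zaremba_cell_cvg hk rhoE sigmaE rho_sigma (j := j) (m := m).
      exact.
  apply/funext => n; congr EFin.
  rewrite /mu_n_integral mulr_suml expnSr mulnBr muln1.
  by apply: eq_bigr => m _; rewrite mulrAC.
- exact: cell_measure_atomless mu_cell mu_out wv.
- have [eta /andP[eta0 eta1] aff] := ghost_mass_affinity hk rhoE rho_sigma.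
  have dec := affinity_decay wP eta0 aff.
  apply: (cell_measure_singular hk l0 wP mu_cell mu_out _ _ dec).
  + by apply: sumr_ge0 => m _; exact: sqrtr_ge0.
  + by rewrite eta0.
Qed.
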